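(* For any finite signature $\Sigma$ and any formulas $\alpha,\beta$ over $\Sigma$, $[\![\alpha\vee\beta]\!]=[\![(\alpha\to\beta)\to\beta]\!]\cap[\![(\beta\to\alpha)\to\alpha]\!]$. Consequently the set of connectives $\{\bot,\wedge,\to\}$ is complete: every formula over $\Sigma$ has the same denotation as some formula built from atoms of $\Sigma$ using only $\bot,\wedge,\to$.
   Context: $\Sigma$ is a finite set of atoms. Formulas are given by $\alpha ::= \bot \mid p \mid \alpha_1\wedge\alpha_2 \mid \alpha_1\vee\alpha_2 \mid \alpha_1\rightarrow\alpha_2$ with $p\in\Sigma$. A partial interpretation is a map $v:\Sigma\to\{0,1,2\}$; $\mathcal I$ is the set of all of them and $\mathcal I_c$ the set of classical ones (no atom mapped to $1$). The order on $\mathcal I$: $u\le v$ iff for every atom $p$, $u(p)\le v(p)$ and ($u(p)=0$ implies $v(p)=0$). For $S\subseteq\mathcal I$: $\overline S=\mathcal I\setminus S$; $S_c=S\cap\mathcal I_c$; $S\downarrow=\{u\in\mathcal I:\exists v\in S,\ v\ge u\}$ (so $S_c\downarrow=(S_c)\downarrow$). The denotation: $[\![\bot]\!]=\emptyset$; $[\![p]\!]=\{v\in\mathcal I: v(p)=2\}$; $[\![\alpha\wedge\beta]\!]=[\![\alpha]\!]\cap[\![\beta]\!]$; $[\![\alpha\vee\beta]\!]=[\![\alpha]\!]\cup[\![\beta]\!]$; $[\![\alpha\to\beta]\!]=\big(\overline{[\![\alpha]\!]}\cup[\![\beta]\!]\big)\cap\big(\overline{[\![\alpha]\!]}\cup[\![\beta]\!]\big)_c\downarrow$.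 *)

(* Defs.v *)
From mathcomp Require Import all_boot.

Set Implicit Arguments.
Unset Strict Implicit.
Unset Printing Implicit Defensive.

Inductive formula (Sigma : Type) : Type :=
| Bot
| Atom of Sigma
| And of formula Sigma & formula Sigma
| Or of formula Sigma & formula Sigma
| Imp of formula Sigma & formula Sigma.

Arguments Bot {Sigma}.

Section Denotation.

Variable Sigma : finType.

Definition interp := {ffun Sigma -> 'I_3}.

Implicit Types (u v : interp) (S : {set interp}).

Definition classical_interps : {set interp} :=
  [set v : interp | [forall p, (v p : nat) != 1]].

Definition interp_le u v : bool :=
  [forall p, (u p <= v p) && (((u p : nat) == 0) ==> ((v p : nat) == 0))].

Definition cpart S : {set interp} := S :&: classical_interps.

Definition down S : {set interp} :=
  [set u : interp | [exists v in S, interp_le u v]].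

Fixpoint denot (a : formula Sigma) : {set interp} :=
  match a with
  | Bot => set0
  | Atom p => [set v : interp | (v p : nat) == 2]
  | And a1 a2 => denot a1 :&: denot a2
  | Or a1 a2 => denot a1 :|: denot a2
  | Imp a1 a2 =>
      (~: denot a1 :|: denot a2) :&: down (cpart (~: denot a1 :|: denot a2))
  end.

End Denotation.

Fixpoint or_free (Sigma : Type) (a : formula Sigma) : bool :=
  match a with
  | Bot => true
  | Atom _ => true
  | And a1 a2 => or_free a1 && or_free a2
  | Or _ _ => false
  | Imp a1 a2 => or_free a1 && or_free a2
  end.

(* Main.v *)
Require Import Defs.
From mathcomp Require Import all_boot.

(** An interpretation [u] has exactly one classical extension, obtained by
    raising every value 1 to 2. Hence membership in a denotation is the
    satisfaction relation of the logic of here-and-there, with [u] as the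
    "here" world and this extension as the "there" world. Denotations are
    closed under passing to the classical extension, and the equation for
    disjunction becomes a propositional tautology in the four truth values of
    [a] and [b] at the two worlds. *)

Section ClassicalExtension.

Variable Sigma : finType.

Implicit Types (u v : interp Sigma) (S : {set interp Sigma}).
Implicit Types a b : formula Sigma.

Definition classical_ext u : interp Sigma :=
  [ffun p => if (u p : nat) == 0 then ord0 else ord_max].

Lemma classical_ext_classical u : classical_ext u \in classical_interps Sigma.
Proof. by rewrite inE; apply/forallP => p; rewrite ffunE; case: ifP. Qed.

Lemma interp_le_classical_ext u : interp_le u (classical_ext u).
Proof.
apply/forallP => p; rewrite ffunE.
by case: (u p) => [[|[|[|m]]] lt_m3].
Qed.

(** The order keeps 0 at 0 and sends 1 and 2 to values at least 1, which classicality forces to be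
    2. *)
Lemma classical_ext_unique u v :
  v \in classical_interps Sigma -> interp_le u v -> v = classical_ext u.
Proof.
rewrite inE => /forallP cl_v /forallP le_uv; apply/ffunP => p.
apply: val_inj; rewrite ffunE; move: (cl_v p) (le_uv p).
by case: (u p) (v p) => [[|[|[|m]]] lt_m3] [[|[|[|n]]] lt_n3].
Qed.

Lemma classical_ext_idem u : classical_ext (classical_ext u) = classical_ext u.
Proof.
by apply/esym/classical_ext_unique;
  [exact: classical_ext_classical | apply/forallP => p; rewrite leqnn implybb].
Qed.

Lemma in_down_cpart S u : (u \in down (cpart S)) = (classical_ext u \in S).
Proof.
rewrite inE; apply/exists_inP/idP => [[v] | Su].
  by rewrite inE => /andP[Sv cl_v] /(classical_ext_unique _ _ cl_v) <-.
exists (classical_ext u); last exact: interp_le_classical_ext.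
by rewrite inE Su classical_ext_classical.
Qed.

Lemma in_denot_Imp a b u :
  (u \in denot (Imp a b)) =
    ((u \in denot a) ==> (u \in denot b)) &&
    ((classical_ext u \in denot a) ==> (classical_ext u \in denot b)).
Proof. by rewrite /= in_setI in_down_cpart !in_setU !in_setC -!implybE. Qed.

(** For an implication, idempotence turns both clauses at [classical_ext u] into the second clause
    at [u]. *)
Lemma denot_classical_ext a u : u \in denot a -> classical_ext u \in denot a.
Proof.
elim: a => [|p|a IHa b IHb|a IHa b IHb|a _ b _].
- by rewrite inE.
- by rewrite !inE ffunE => /eqP ->.
- by rewrite /= !in_setI => /andP[/IHa-> /IHb->].
- by rewrite /= !in_setU => /orP[/IHa-> | /IHb->]; rewrite ?orbT.
- by rewrite !in_denot_Imp classical_ext_idem => /andP[_ ->].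
Qed.

Lemma denot_Or_Imp a b :
  denot (Or a b) = denot (Imp (Imp a b) b) :&: denot (Imp (Imp b a) a).
Proof.
apply/setP => u; rewrite in_setI !in_denot_Imp classical_ext_idem in_setU.
move: (denot_classical_ext a u) (denot_classical_ext b u).
(* Persistence fixes the value at [classical_ext u] of each formula true at [u]; the other values
   are free and are split on below. *)
case: (u \in denot a) => [->|_] //; case: (u \in denot b) => [->|_] //=;
  rewrite ?implybT ?andbT //;
  by case: (_ \in denot a); case: (_ \in denot b).
Qed.

End ClassicalExtension.

Fixpoint elim_or {T : Type} (a : formula T) : formula T :=
  match a with
  | Bot => Bot
  | Atom p => Atom p
  | And a1 a2 => And (elim_or a1) (elim_or a2)
  | Or a1 a2 =>
      And (Imp (Imp (elim_or a1) (elim_or a2)) (elim_or a2))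
          (Imp (Imp (elim_or a2) (elim_or a1)) (elim_or a1))
  | Imp a1 a2 => Imp (elim_or a1) (elim_or a2)
  end.

Lemma or_free_elim_or (T : Type) (a : formula T) : or_free (elim_or a).
Proof. by elim: a => //= a -> b ->. Qed.

Lemma denot_elim_or (Sigma : finType) (a : formula Sigma) :
  denot (elim_or a) = denot a.
Proof.
elim: a => //= [a -> b -> //|a IHa b IHb|a -> b -> //].
(* Denotations are compositional, so the induction hypotheses replace [elim_or a] and [elim_or b] by
   [a] and [b]. *)
by rewrite IHa IHb; exact/esym/denot_Or_Imp.
Qed.

Theorem theorem3 (Sigma : finType) :
  (forall a b : formula Sigma,
     denot (Or a b) = denot (Imp (Imp a b) b) :&: denot (Imp (Imp b a) a)) /\
  (forall a : formula Sigma,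
     exists b : formula Sigma, or_free b /\ denot b = denot a).
Proof.
split=> [|a]; first exact: denot_Or_Imp.
by exists (elim_or a); split; [exact: or_free_elim_or | exact: denot_elim_or].
Qed.
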